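(* Assume that $\nu$ is a proper lower semi-continuous function with $\nu(\bar s)\in\mathbb{R}$ and $\bar s\in\mathrm{dom}\,\partial\nu$. Let $r>0$ and let $l_r$ be the augmented Lagrangian. Assume that $g$ is a smooth mapping from $\mathbb{R}^n$ to $\mathcal{Y}$. Then $(\bar x,\bar y)$ is a solution to the problem $$\min\ f(x)\quad\text{s.t.}\quad g(x)+\bar s=y,\ \ y\in K$$ if and only if there exists some $\bar\lambda\in\mathcal{Y}$ such that $$(\bar x,\bar y)\in\mathrm{argmin}_{x\in\mathbb{R}^n,\,y\in K}\,l_r(x,y,\bar\lambda),\qquad \mathrm{D}g(\bar x)^*(g(\bar x)-\bar y)=0,\qquad \Pi_K(g(\bar x))=\bar y.$$
   Context: Standing setting: $\mathcal{Y}$ is a finite dimensional Hilbert space, $K\subset\mathcal{Y}$ is a nonempty closed convex set, $f:\mathbb{R}^n\to\mathbb{R}$ is convex and continuously differentiable, $g:\mathbb{R}^n\to\mathcal{Y}$ is continuously differentiable (this is what ''smooth'' means here), and $G_K(x)=-g(x)+K$ is graph-convex, i.e. $\{(x,s)\in\mathbb{R}^n\times\mathcal{Y}: g(x)+s\in K\}$ is convex. $\mathcal{S}=\{s\in\mathcal{Y}:\exists x\in\mathbb{R}^n,\ g(x)+s\in K\}$ is assumed closed with $0\notin\mathcal{S}$, and $\bar s=\mathrm{argmin}\{\frac12\|s\|^2: s\in\mathcal{S}\}$ is the projection of $0$ onto $\mathcal{S}$. $\nu(s)=\inf\{f(x): x\in\mathbb{R}^n,\ g(x)+s\in K\}$ (with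 $\inf\emptyset=+\infty$), $\partial\nu$ is its convex subdifferential and $\mathrm{dom}\,\partial\nu=\{s:\partial\nu(s)\neq\emptyset\}$. The augmented Lagrangian is $l_r(x,y,\lambda)=f(x)+\langle\lambda,g(x)-y\rangle+\frac r2\|g(x)-y\|^2$. $\mathrm{D}g(x)^*$ is the adjoint of the derivative of $g$ at $x$, and $\Pi_K$ is the metric projection onto $K$. *)

(* Defs.v *)
From HB Require Import structures.
From mathcomp Require Import all_boot all_order all_algebra.
From mathcomp Require Import all_classical all_reals all_analysis.
Set Implicit Arguments.
Unset Strict Implicit.
Unset Printing Implicit Defensive.
Import Order.TTheory GRing.Theory Num.Theory.
Import numFieldNormedType.Exports.

Local Open Scope classical_set_scope.
Local Open Scope ring_scope.

(* Finite dimensional real Hilbert spaces: finite dimensionality is the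
   [Vector] structure, and completeness is then automatic. *)
HB.mixin Record isHilbertian (R : realType) (Y : Type)
    of NormedModule R Y & Vector R Y := {
  inner : {dot Y for idfun} ;
  normr_inner : forall y : Y, `|y| ^+ 2 = inner y y
}.

#[short(type="finHilbertType")]
HB.structure Definition FinHilbert (R : realType) :=
  { Y of isHilbertian R Y & NormedModule R Y & Vector R Y }.

Notation "'<< u , v >>" := (inner u v)
  (at level 0, u, v at level 99, format "''<<' u ,  v '>>'") : ring_scope.

Section Generic.
Context {R : realType}.

Definition argmin {T : Type} (A : set T) (h : T -> R) : set T :=
  [set a | A a /\ forall b, A b -> h a <= h b].

(* The second clause is the continuity of [x |-> 'd f x] for the operator
   norm. *)
Definition continuously_differentiable {V W : normedModType R} (f : V -> W) :=
  (forall x, differentiable f x) /\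
  (forall (x : V) (e : R), 0 < e ->
     \forall z \near x, forall h, `|'d f z h - 'd f x h| <= e * `|h|).

Definition proper_function {T : Type} (h : T -> \bar R) :=
  (exists t, (h t < +oo)%E) /\ (forall t, (-oo < h t)%E).

End Generic.

Section Hilbert.
Context {R : realType} {Y : finHilbertType R}.

(* For nonempty closed convex [K] the minimizer exists and is unique; the
   default value 0 is irrelevant then. *)
Definition metric_projection (K : set Y) (z : Y) : Y :=
  xget 0 (argmin K (fun y => `|z - y|)).

Definition subdifferential (h : Y -> \bar R) (s : Y) : set Y :=
  [set l | forall t, (h s + '<<l, t - s>>%:E <= h t)%E].

Definition dom_subdifferential (h : Y -> \bar R) : set Y :=
  [set s | subdifferential h s !=set0].

(* Adjoint of a linear map for the Euclidean inner product of R^n, see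
   [adjointE]. The norm of ['rV[R]_n] is the sup norm, which only matters
   through its topology. *)
Definition adjoint {n : nat} (A : 'rV[R]_n -> Y) (y : Y) : 'rV[R]_n :=
  \row_i '<<A 'e_i, y>>.

Lemma adjointE {n : nat} (A : {linear 'rV[R]_n -> Y}) (h : 'rV[R]_n) (y : Y) :
  '<<A h, y>> = \sum_i h ord0 i * adjoint A y ord0 i.
Proof.
rewrite {1}(row_sum_delta h) linear_sum linear_sumlz.
by apply: eq_bigr => i _; rewrite mxE linearZ linearZl_LR.
Qed.

Section Problem.
Context {n : nat} (f : 'rV[R]_n -> R) (g : 'rV[R]_n -> Y) (K : set Y).

Definition graph_convex := convex_set [set p : 'rV[R]_n * Y | K (g p.1 + p.2)].

Definition feasible_shifts : set Y := [set s | exists x, K (g x + s)].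

Definition value_function (s : Y) : \bar R :=
  ereal_inf [set (f x)%:E | x in [set x | K (g x + s)]].

Definition augmented_lagrangian (r : R) (x : 'rV[R]_n) (y l : Y) : R :=
  f x + '<<l, g x - y>> + r / 2 * `|g x - y| ^+ 2.

Definition shifted_solution (s : Y) : set ('rV[R]_n * Y) :=
  argmin [set p | g p.1 + s = p.2 /\ K p.2] (fun p => f p.1).

End Problem.
End Hilbert.

(* Main.v *)
Require Import Defs.
From HB Require Import structures.
From mathcomp Require Import all_boot all_order all_algebra.
From mathcomp Require Import all_classical all_reals all_analysis.
From mathcomp Require Import ring lra.
Set Implicit Arguments.
Unset Strict Implicit.
Unset Printing Implicit Defensive.
Import Order.TTheory GRing.Theory Num.Theory.
Import numFieldNormedType.Exports.

Local Open Scope classical_set_scope.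
Local Open Scope ring_scope.

(** Write [s = y - g x] for the shift that makes [(x, y)] feasible. Then
    [f x + <l, g x - y> + r/2 |g x - y|^2 = f x - <l, s> + r/2 |s|^2], so
    minimizing the augmented Lagrangian over [x] and [y \in K] is minimizing
    [nu s - <l, s> + r/2 |s|^2] over [s].

    From a solution of the shifted problem to a multiplier: if [mu] is a
    subgradient of [nu] at [sbar], the choice [l = mu + r sbar] turns this
    function into [nu s - <mu, s> + r/2 |s - sbar|^2] up to a constant, and each
    of the two parts is minimal at [sbar]. The shifts [y - g xbar], [y \in K],
    and [ybar - g x] all belong to the convex set [S] of feasible shifts, of
    which [sbar] is the projection of 0. The variational inequality of that
    projection, tested on the first family, says that [ybar] is the projection
    of [g xbar] on [K]; tested on the second, it says that [<sbar, g x>] is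
    maximal at [xbar], so its derivative vanishes there.

    Conversely, put [s = ybar - g xbar] and let [s'] be any feasible shift,
    feasible at [x']. Graph-convexity keeps [g (x_t) + s_t] in [K] along the
    segment from [(xbar, s)] to [(x', s')]. Testing the variational inequality
    of the projection of [g xbar] on [K] at these points, dividing by [t] and
    letting [t] tend to 0, the term in [g] disappears because
    [Dg(xbar)^* s = 0], and [0 <= <s, s' - s>] remains. Hence [s] is the
    projection of 0 on [S], that is [s = sbar]
    ([variational_unique]). Along [y = g x + sbar] the last two terms of the
    Lagrangian are constant, so its minimality among these points is optimality
    in the shifted problem.

    Two tools carry this: [closest_point_variational], the description of
    closest points by a variational inequality, and
    [directional_derivative_ge0], the passage to the limit. In the converse one
    must know that [metric_projection] is a genuine closest point, which is
    [closest_point_exists]. *)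

(** * Inner product and closest points of convex sets *)

Lemma convex_set_segment (R : realType) (M : lmodType R) (A : set M) (x y : M)
    (t : R) :
  convex_set A -> A x -> A y -> 0 <= t -> t <= 1 -> A (x + t *: (y - x)).
Proof.
move=> cA Ax Ay t0 t1.
have -> : x + t *: (y - x) = t *: y + (1 - t) *: x.
  by rewrite scalerBl scale1r scalerBr addrCA.
by have := cA y x (Itv01 t0 t1); rewrite !inE; apply.
Qed.

(** If [p] were positive, [t = p / (p + q)] would be a step short enough for the
    linear term to win over the quadratic one. *)
Lemma quadratic_slope_le0 (R : realFieldType) (p q : R) : 0 <= q ->
  (forall t, 0 <= t -> t <= 1 -> t * p *+ 2 <= t ^+ 2 * q) -> p <= 0.
Proof.
move=> q0 H; rewrite leNgt; apply/negP => p0.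
have pq : 0 < p + q by lra.
have t0 : 0 < p / (p + q) by rewrite divr_gt0.
have t1 : p / (p + q) <= 1 by rewrite ler_pdivrMr//; lra.
have := H _ (ltW t0) t1.
rewrite expr2 -mulrnAr -mulrA ler_pM2l// mulrAC ler_pdivlMr//.
nra.
Qed.

Section InnerProduct.
Context {R : realType} {Y : finHilbertType R}.
Implicit Types u v w : Y.

Lemma innerC u v : '<<u, v>> = '<<v, u>>.
Proof. by rewrite hermC expr0 mul1r. Qed.

Lemma innerDr u v w : '<<u, v + w>> = '<<u, v>> + '<<u, w>>.
Proof. exact: linearDr. Qed.

Lemma innerNr u v : '<<u, - v>> = - '<<u, v>>.
Proof. exact: linearNr. Qed.

Lemma innerDl u v w : '<<u + v, w>> = '<<u, w>> + '<<v, w>>.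
Proof. exact: linearDl. Qed.

Lemma innerNl u v : '<<- u, v>> = - '<<u, v>>.
Proof. exact: linearNl. Qed.

Lemma innerZl u (t : R) v : '<<t *: u, v>> = t * '<<u, v>>.
Proof. by rewrite linearZl_LR. Qed.

Lemma innerZr u (t : R) v : '<<u, t *: v>> = t * '<<u, v>>.
Proof. by rewrite linearZ. Qed.

Lemma sqr_normD u v : `|u + v| ^+ 2 = `|u| ^+ 2 + '<<u, v>> *+ 2 + `|v| ^+ 2.
Proof.
rewrite !normr_inner innerDr !innerDl (innerC v u); ring.
Qed.

(** The norm is continuous, and the inner product is recovered from it by
    polarization. *)
Lemma inner_continuous u : continuous (inner u : Y -> R).
Proof.
have -> : (inner u : Y -> R) =
    fun v => 2^-1 * (`|u + v| ^+ 2 - `|u| ^+ 2 - `|v| ^+ 2).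
  by apply/funext => v; rewrite sqr_normD; field.
move=> v; apply: cvgM; first exact: cvg_cst.
apply: cvgB; first apply: cvgB; last first.
- by apply: cvgM; apply: cvg_norm; exact: cvg_id.
- exact: cvg_cst.
by apply: cvgM; apply: cvg_norm; apply: cvgD => //; exact: cvg_cst.
Qed.

(** Moving from [a] towards [b] by a fraction [t] changes the squared distance
    to [z] by [- 2 t <z - a, b - a> + t^2 |b - a|^2]. Small [t] give one
    direction and [t = 1] the other. *)
Lemma closest_point_variational (A : set Y) (z a : Y) : convex_set A -> A a ->
  (forall b, A b -> `|z - a| <= `|z - b|) <->
  (forall b, A b -> '<<z - a, b - a>> <= 0).
Proof.
have expand b (t : R) : `|z - (a + t *: (b - a))| ^+ 2 =
    `|z - a| ^+ 2 - t * '<<z - a, b - a>> *+ 2 + t ^+ 2 * `|b - a| ^+ 2.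
  rewrite opprD addrA [LHS]sqr_normD innerNr normrN.
  by rewrite innerZr normrZ exprMn real_normK ?num_real// mulNrn.
move=> cA Aa; split=> H b Ab; last first.
  rewrite -(ler_pXn2r (n := 2)) ?nnegrE//.
  have -> : b = a + 1 *: (b - a) by rewrite scale1r addrC subrK.
  rewrite expand; have := H b Ab; have := sqr_ge0 `|b - a|. lra.
apply: (quadratic_slope_le0 (sqr_ge0 `|b - a|)) => t t0 t1.
have := H _ (convex_set_segment cA Aa Ab t0 t1).
rewrite -(ler_pXn2r (n := 2)) ?nnegrE// expand. lra.
Qed.

(** Adding the two inequalities, tested at each other's point, gives
    [|a - a'|^2 <= 0]. *)
Lemma variational_unique (A : set Y) (z a a' : Y) : A a -> A a' ->
  (forall b, A b -> '<<z - a, b - a>> <= 0) ->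
  (forall b, A b -> '<<z - a', b - a'>> <= 0) -> a = a'.
Proof.
move=> Aa Aa' /(_ _ Aa') h /(_ _ Aa) h'.
apply/eqP; rewrite -subr_eq0 -normr_eq0 -sqrf_eq0.
rewrite eq_le sqr_ge0 andbT normr_inner.
have -> : '<<a - a', a - a'>> = '<<z - a, a' - a>> + '<<z - a', a - a'>>.
  rewrite -(opprB a a') innerNr -innerNl -innerDl.
  by congr (inner _ _); rewrite opprB addrA subrK.
lra.
Qed.

End InnerProduct.

(** * Existence of closest points in finite dimension *)

Section FiniteDimension.
Context {R : realType} {n : nat} {V : normedModType R}.
Variable phi : {linear 'rV[R]_n -> V}.

Lemma linear_rV_continuous : continuous phi.
Proof.
move=> v.
have -> : (phi : 'rV[R]_n -> V) =
    fun w => \sum_i w ord0 i *: phi (delta_mx ord0 i).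
  apply/funext => w; rewrite {1}(row_sum_delta w) linear_sum.
  by apply: eq_bigr => i _; rewrite linearZ.
apply: (@cvg_big V _ +%R _ _ add_continuous _ (nbhs v)) => i _.
apply: cvgZr_tmp.
exact: coord_continuous.
Qed.

(** The constant is the minimum of [|phi v|] over the unit sphere, which is
    compact for the sup norm; it is positive by injectivity. *)
Lemma injective_linear_coercive : injective phi ->
  exists2 c : R, 0 < c & forall v, c * `|v| <= `|phi v|.
Proof.
move=> phi_inj; pose S := [set v : 'rV[R]_n | `|v| = 1].
have S_closed : closed S.
  apply: (@preimage_closed _ _ (fun v : 'rV[R]_n => `|v|) [set 1]).
    by move=> v _; exact: norm_continuous.
  exact: closed_eq.
have S_compact : compact S.
  apply: bounded_closed_compact => //.
  by exists 1; split; [exact: num_real | move=> M M1 v /= ->; exact: ltW].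
have [S0|S_neq0] := pselect (S !=set0); last first.
  (* The sphere is empty exactly when the space of rows is trivial. *)
  exists 1 => // v; suff -> : v = 0 by rewrite linear0 !normr0 mulr0.
  apply: contrapT => /eqP v0; apply: S_neq0.
  by exists (`|v|^-1 *: v); rewrite /S /= normfZV.
have [|v0 + v0_min] := @EVT_min_rV _ _ (fun v => `|phi v|) _ S0 S_compact.
  apply: continuous_subspaceT => v.
  exact: (continuous_comp (@linear_rV_continuous v) (@norm_continuous _ _ _)).
rewrite inE => Sv0; exists `|phi v0|.
  rewrite normr_gt0; apply/eqP; rewrite -(linear0 phi) => /phi_inj v00.
  by move: Sv0; rewrite v00 /S /= normr0 => /eqP; rewrite eq_sym oner_eq0.
move=> v; have [->|v_neq0] := eqVneq v 0.
  by rewrite linear0 !normr0 mulr0.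
have := v0_min (`|v|^-1 *: v); rewrite inE /S /= normfZV// => /(_ erefl).
by rewrite linearZ normrZ normfV normr_id ler_pdivlMl ?normr_gt0// mulrC.
Qed.

(** The distance to [z] is minimized in the coordinates given by [phi], where
    closed bounded sets are compact; coercivity bounds the set of candidates at
    least as close to [z] as a given point of [A]. *)
Lemma closest_point_exists (A : set V) (z : V) :
  bijective phi -> closed A -> A !=set0 ->
  exists2 a, A a & forall b, A b -> `|z - a| <= `|z - b|.
Proof.
move=> phi_bij A_closed [a0 Aa0].
have [psi phiK psiK] := phi_bij.
have [c c0 c_phi] := injective_linear_coercive (can_inj phiK).
have dist_cont : continuous (fun v => `|z - phi v|).
  by move=> v; exact: cvg_norm (cvgB (cvg_cst z) (@linear_rV_continuous v)).
pose D := phi @^-1` A `&`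
  (fun v => `|z - phi v|) @^-1` [set t | t <= `|z - a0|].
have D_closed : closed D.
  apply: closedI.
    by apply: preimage_closed => // v _; exact: linear_rV_continuous.
  apply: preimage_closed; last exact: closed_le.
  by move=> v _; exact: dist_cont.
have D_bounded : bounded_set D.
  exists (c^-1 * (`|z| + `|z - a0|)); split; first exact: num_real.
  move=> M M1 v [_ vD]; apply: ltW; apply: le_lt_trans M1.
  rewrite ler_pdivlMl//; apply: le_trans (c_phi v) _.
  rewrite -[X in `|X|](subKr z).
  by apply: le_trans (ler_normB _ _) _; rewrite lerD2l.
have D_compact := bounded_closed_compact D_bounded D_closed.
have D0 : D !=set0 by exists (psi a0); rewrite /D /= psiK.
have [|v + v_min] := @EVT_min_rV _ _ (fun v => `|z - phi v|) _ D0 D_compact.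
  exact: continuous_subspaceT.
rewrite inE => -[/= Av vD]; exists (phi v) => // b Ab.
have [bD|bD] := leP `|z - b| `|z - a0|.
  by have := v_min (psi b); rewrite inE /D /= psiK; apply.
exact: le_trans vD (ltW bD).
Qed.

End FiniteDimension.

(** * Metric projection and one-sided derivatives *)

Section Projection.
Import VectorInternalTheory.
Context {R : realType} {Y : finHilbertType R}.

(** Existence of a closest point rules out the default value in the definition
    of [metric_projection], and convexity makes the closest point unique. *)
Lemma metric_projectionP (K : set Y) (z y : Y) :
  closed K -> convex_set K -> K !=set0 ->
  metric_projection K z = y <->
  K y /\ forall b, K b -> '<<z - y, b - y>> <= 0.
Proof.
move=> K_closed K_convex K_neq0.
have [y0 Ky0 y0_min] : exists2 a, K a & forall b, K b -> `|z - a| <= `|z - b|.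
  apply: (closest_point_exists (phi := r2v)) => //.
  by exists v2r; [exact: r2vK | exact: v2rK].
have VI a : argmin K (fun y => `|z - y|) a <->
    K a /\ forall b, K b -> '<<z - a, b - a>> <= 0.
  split=> -[Ka /closest_point_variational]; rewrite /argmin /=; move: Ka;
    by [move=> ? ?; split; auto | ].
have proj_min : argmin K (fun y => `|z - y|) (metric_projection K z).
  by apply: (xgetPex 0); exists y0.
split=> [<-|[Ky y_VI]]; first exact/VI.
by have [Kp p_VI] := (VI _).1 proj_min; exact: variational_unique p_VI y_VI.
Qed.

(** Divide by [t] and let [t] tend to 0 from the right. The term [t * c] is what
    a shift moving linearly in [t] contributes along a segment of the graph. *)
Lemma directional_derivative_ge0 (V : normedModType R) (g : V -> Y) (x h : V)
    (s : Y) (c : R) :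
  differentiable g x ->
  (forall t : R, 0 < t -> t <= 1 ->
    0 <= '<<s, g (x + t *: h) - g x>> + t * c) ->
  0 <= '<<s, 'd g x h>> + c.
Proof.
move=> g_diff H.
pose q (t : R) := t^-1 *: (g (t *: h + x) - g x).
have q_cvg : q t @[t --> 0^'+] --> 'd g x h.
  apply: cvg_dnbhs_at_right; rewrite -deriveE//.
  exact: diff_derivable.
have l_cvg : '<<s, q t>> + c @[t --> 0^'+] --> '<<s, 'd g x h>> + c.
  apply: cvgD; last exact: cvg_cst.
  exact: (cvg_comp _ _ q_cvg (@inner_continuous _ _ s ('d g x h))).
rewrite -(cvg_lim _ l_cvg)//; apply: limr_ge.
  by apply/cvg_ex; eexists; exact: l_cvg.
near=> t.
have t0 : 0 < t by [].
have t1 : t <= 1 by near: t; exact: nbhs_right_le.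
rewrite /q innerZr -(pmulr_rge0 _ t0) mulrDr mulrA mulfV ?gt_eqF// mul1r.
by rewrite (addrC (t *: h)); exact: H.
Unshelve. all: by end_near.
Qed.

End Projection.

(** * Feasible shifts and the value function *)

Section Shifts.
Context {R : realType} {n : nat} {Y : finHilbertType R}.
Variables (f : 'rV[R]_n -> R) (g : 'rV[R]_n -> Y) (K : set Y).

Lemma graph_convex_segment (x x' : 'rV[R]_n) (s s' : Y) (t : R) :
  graph_convex g K -> K (g x + s) -> K (g x' + s') -> 0 <= t -> t <= 1 ->
  K (g (x + t *: (x' - x)) + (s + t *: (s' - s))).
Proof.
move=> gK Ks Ks' t0 t1.
exact: (@convex_set_segment _ ('rV[R]_n * Y)%type _ (x, s) (x', s') t gK).
Qed.

Lemma feasible_shifts_convex :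
  graph_convex g K -> convex_set (feasible_shifts g K).
Proof.
move=> gK s s' t; rewrite !inE => -[x Kx] [x' Kx'].
exists (conv t (x : convex_lmodType _) x').
have := gK (x, s) (x', s') t; rewrite !inE; exact.
Qed.

Lemma value_function_le (x : 'rV[R]_n) (s : Y) :
  K (g x + s) -> (value_function f g K s <= (f x)%:E)%E.
Proof. by move=> Ks; apply: ereal_inf_lbound; exists x. Qed.

Lemma shifted_solution_value (s : Y) (x : 'rV[R]_n) (y : Y) :
  shifted_solution f g K s (x, y) -> value_function f g K s = (f x)%:E.
Proof.
move=> [/= [gxs Ky] min_x]; apply/eqP; rewrite eq_le.
rewrite value_function_le ?gxs//=; apply: le_ereal_inf_tmp => _ [x' Kx' <-].
by rewrite lee_fin; apply: (min_x (x', g x' + s)).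
Qed.

End Shifts.

(** * Shifted solutions and the augmented Lagrangian *)

Theorem theorem4p1 (R : realType) (n : nat) (Y : finHilbertType R)
  (K : set Y) (f : 'rV[R]_n -> R) (g : 'rV[R]_n -> Y) (sbar : Y) (r : R)
  (K_neq0 : K !=set0) (K_closed : closed K) (K_convex : convex_set K)
  (f_convex : convex_function setT f) (f_C1 : continuously_differentiable f)
  (g_C1 : continuously_differentiable g)
  (G_convex : graph_convex g K)
  (S_closed : closed (feasible_shifts g K))
  (S_not0 : ~ feasible_shifts g K 0)
  (sbarE : argmin (feasible_shifts g K) (fun s => 2^-1 * `|s| ^+ 2) sbar)
  (nu_proper : proper_function (value_function f g K))
  (nu_lsc : lower_semicontinuous (value_function f g K))
  (nu_sbar : value_function f g K sbar \is a fin_num)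
  (sbar_dom : dom_subdifferential (value_function f g K) sbar)
  (r_gt0 : 0 < r)
  (xbar : 'rV[R]_n) (ybar : Y) :
  shifted_solution f g K sbar (xbar, ybar) <->
  exists lbar : Y,
    [/\ argmin [set p | K p.2]
          (fun p => augmented_lagrangian f g r p.1 p.2 lbar) (xbar, ybar),
        adjoint ('d g xbar) (g xbar - ybar) = 0
      & metric_projection K (g xbar) = ybar].
Proof.
have S_convex := feasible_shifts_convex G_convex.
have [[x0 Kx0] sbar_min] := sbarE.
have Ssbar : feasible_shifts g K sbar by exists x0.
have sbar_VI s : feasible_shifts g K s -> '<<0 - sbar, s - sbar>> <= 0.
  apply/closest_point_variational : s => // s Ss.
  rewrite !sub0r !normrN -(ler_pXn2r (n := 2)) ?nnegrE//.
  by have /= := sbar_min s Ss; rewrite ler_pM2l ?invr_gt0.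
have g_diff : differentiable g xbar by have [] := g_C1.
split.
  move=> xy_sol; have nu_x := shifted_solution_value xy_sol.
  have [[/= gs Ky] f_min] := xy_sol.
  have gy : g xbar - ybar = - sbar by rewrite -gs opprD addrA subrr sub0r.
  have [mu mu_sub] := sbar_dom.
  (* The summand [r *: sbar] recentres the quadratic penalty at [sbar]. *)
  exists (mu + r *: sbar); split.
  - split=> //= -[x y] /= Ky'.
    pose s := y - g x.
    have Ks : K (g x + s) by rewrite addrC subrK.
    have mu_le : f xbar + '<<mu, s - sbar>> <= f x.
      rewrite -lee_fin EFinD -nu_x.
      exact: le_trans (mu_sub s) (value_function_le f Ks).
    (* The penalty terms of the Lagrangian at shift [u], with the square
       completed around [sbar]. *)
    have ls (u : Y) : '<<mu + r *: sbar, - u>> + r / 2 * `|- u| ^+ 2 =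
        r / 2 * `|u - sbar| ^+ 2 - '<<mu, u - sbar>> - '<<mu, sbar>>
        - r / 2 * `|sbar| ^+ 2.
      have -> : '<<mu + r *: sbar, - u>> = - '<<mu, u>> - r * '<<sbar, u>>.
        by rewrite innerNr innerDl opprD innerZl.
      rewrite sqr_normD !normrN innerNr innerDr innerNr (innerC u).
      by field.
    rewrite /augmented_lagrangian gy -[g x - y]opprB -/s -!addrA !ls.
    rewrite subrr linear0 normr0 expr0n mulr0 /=.
    have : 0 <= r / 2 * `|s - sbar| ^+ 2.
      by rewrite mulr_ge0 ?sqr_ge0// divr_ge0// ltW.
    lra.
  - apply/rowP => i; rewrite !mxE gy innerNr innerC.
    (* [<sbar, g x>] is maximal at [xbar]: its derivative has a sign in every
       direction, so it vanishes. *)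
    have ge0 h : 0 <= '<<- sbar, 'd g xbar h>>.
      rewrite -[leRHS]addr0; apply: directional_derivative_ge0 => // t t0 t1.
      rewrite mulr0 addr0; set x := xbar + _.
      have -> : g x - g xbar = - (ybar - g x - sbar).
        by rewrite -gs addrAC addrK opprB.
      rewrite innerNr oppr_ge0 -[X in '<<X, _>>]sub0r; apply: sbar_VI.
      by exists x; rewrite addrC subrK.
    have := ge0 (- 'e_i); have := ge0 'e_i.
    by rewrite linearN !innerNl innerNr; lra.
  - apply/metric_projectionP => //; split=> // b Kb.
    have Sb : feasible_shifts g K (b - g xbar).
      by exists xbar; rewrite addrC subrK.
    have := sbar_VI _ Sb; rewrite gy sub0r.
    by rewrite -[ybar]gs opprD addrA.
move=> [l [[/= Ky l_min] adj0 /metric_projectionP]].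
case=> // _ y_VI.
set s := ybar - g xbar.
have gs : g xbar + s = ybar by rewrite addrC subrK.
have d0 h : '<<s, 'd g xbar h>> = 0.
  rewrite /s -opprB innerNl innerC adjointE adj0 big1 ?oppr0// => i _.
  by rewrite mxE mulr0.
have s_VI s' : feasible_shifts g K s' -> '<<0 - s, s' - s>> <= 0.
  move=> [x' Kx']; rewrite sub0r innerNl oppr_le0.
  rewrite -[leRHS]add0r -[X in X + _](d0 (x' - xbar)).
  apply: directional_derivative_ge0 => // t t0 t1.
  have Kt : K (g (xbar + t *: (x' - xbar)) + (s + t *: (s' - s))).
    by apply: (graph_convex_segment G_convex _ Kx' (ltW t0) t1); rewrite gs.
  have := y_VI _ Kt; rewrite -[g xbar - ybar]opprB -/s innerNl oppr_le0.
  rewrite -gs (addrC (g xbar) s) (addrC s (t *: _)) addrA addrKA addrAC.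
  by rewrite (innerDr s _ (t *: _)) innerZr.
have sE : s = sbar.
  apply: variational_unique s_VI sbar_VI => //.
  by exists xbar; rewrite gs.
split=> /=; first by rewrite -sE.
move=> [x y] /= [gx Kx].
(* At shift [sbar] only the term in [f] depends on the point. *)
have := l_min (x, y) Kx.
rewrite /augmented_lagrangian /= -gx -[ybar]gs sE !opprD !addrA !subrr.
by rewrite -!addrA lerD2r.
Qed.
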